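(* Let $\nu\ge 1$ be a fixed integer and let $\mathbf H$ be an $\mathbb R^\nu$-valued random variable whose probability density function $p_{\mathbf H}$ (with respect to Lebesgue measure) is continuous on $\mathbb R^\nu$. For each $N$, let $\widehat{\mathbf H}^1,\dots,\widehat{\mathbf H}^N$ be $N$ independent copies of $\mathbf H$ and, for $\eta\in\mathbb R^\nu$, let $$P^{(N)}(\eta)=\frac1N\sum_{j=1}^N \pi_{\nu,N}\Big(\frac{\widehat s}{s}\widehat{\mathbf H}^j-\eta\Big),$$ with $\pi_{\nu,N}$, $s$, $\widehat s$ (depending on $\nu$ and $N$) as defined in the context. Then for all $\eta\in\mathbb R^\nu$, the mean $\underline P^{(N)}(\eta)=E\{P^{(N)}(\eta)\}$ and the variance $\mathrm{Var}\{P^{(N)}(\eta)\}=E\{(P^{(N)}(\eta)-\underline P^{(N)}(\eta))^2\}$ satisfy $$\lim_{N\to+\infty}\underline P^{(N)}(\eta)=p_{\mathbf H}(\eta),\qquad \mathrm{Var}\{P^{(N)}(\eta)\}\le N^{-4/(\nu+4)}\,\beta_{\nu,N}\,\underline P^{(N)}(\eta),$$ where $\beta_{\nu,N}$ is a positive constant (depending only on $\nu$ and $N$) such that, for $\nu$ fixed and $N\to+\infty$, $$\beta_{\nu,N}\sim(2\pi)^{-\nu/2}\Big(\frac{2+\nu}{4}\Big)^{\nu/(\nu+4)}.$$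
   Context: For integers $\nu\ge1$ and $N$, set $$s=\Big(\frac{4}{N(\nu+2)}\Big)^{1/(\nu+4)},\qquad \widehat s=\frac{s}{\sqrt{s^2+\frac{N-1}{N}}},\qquad \pi_{\nu,N}(\eta)=\frac{1}{(\sqrt{2\pi}\,\widehat s)^\nu}\exp\Big\{-\frac{1}{2\widehat s^2}\|\eta\|^2\Big\},\quad \eta\in\mathbb R^\nu,$$ where $\|\cdot\|$ is the Euclidean norm. $E$ denotes mathematical expectation. The notation $\beta_{\nu,N}\sim c$ means $\beta_{\nu,N}/c\to1$. *)

(* Defs.v *)
From HB Require Import structures.
From mathcomp Require Import all_boot all_order all_algebra.
From mathcomp Require Import all_classical all_reals all_analysis.

Set Implicit Arguments.
Unset Strict Implicit.
Unset Printing Implicit Defensive.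

Import Order.TTheory GRing.Theory Num.Theory.
Import numFieldNormedType.Exports.

Local Open Scope classical_set_scope.
Local Open Scope ring_scope.

(* R^n is ['rV[R]_n]: it already carries the usual topology. Its sigma-algebra
   is generated by the coordinate maps (as the library does for [n.-tuple T]);
   this is the Borel sigma-algebra. *)
Definition measure_rV_display : measure_display.
Proof. exact: default_measure_display. Qed.

Section measurable_rV.
Variables (R : realType) (n : nat).

Let coors : 'I_n -> 'rV[R]_n -> measurableTypeR R := fun i v => v ord0 i.

Let rV_set0 : g_sigma_preimage coors set0.
Proof. exact: sigma_algebra0. Qed.

Let rV_setC A : g_sigma_preimage coors A -> g_sigma_preimage coors (~` A).
Proof. exact: sigma_algebraC. Qed.

Let rV_bigcup (F : _^nat) : (forall i, g_sigma_preimage coors (F i)) ->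
  g_sigma_preimage coors (\bigcup_i (F i)).
Proof. exact: sigma_algebra_bigcup. Qed.

HB.instance Definition _ := @isMeasurable.Build measure_rV_display
  'rV[R]_n (g_sigma_preimage coors) rV_set0 rV_setC rV_bigcup.

Lemma measurable_coord (i : 'I_n) :
  measurable_fun [set: 'rV[R]_n]
    ((fun v => v ord0 i) : 'rV[R]_n -> measurableTypeR R).
Proof.
move=> _ Y mY; rewrite setTI; apply: sub_sigma_algebra => /=.
rewrite -bigcup_seq/=; exists i => /=; first by rewrite mem_index_enum.
by exists Y => //; rewrite setTI.
Qed.

Lemma measurable_fun_rVP d (T : measurableType d) (f : T -> 'rV[R]_n) :
  (forall i, measurable_fun [set: T]
     ((fun t => f t ord0 i) : T -> measurableTypeR R)) ->
  measurable_fun [set: T] f.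
Proof.
move=> mf.
suff : g_sigma_preimage (fun i t => coors i (f t)) `<=` measurable.
  rewrite (g_sigma_preimage_comp coors f) => fS _ A mA.
  by apply: fS; exists A.
apply: smallest_sub; first exact: sigma_algebra_measurable.
rewrite -bigcup_seq; apply: bigcup_sub => i _.
by move=> A [B mB <-]; exact: mf.
Qed.

End measurable_rV.

Section cons_rV.
Variables (R : realType) (n : nat).

Definition cons_rV (p : measurableTypeR R * 'rV[R]_n) : 'rV[R]_n.+1 :=
  \row_i oapp (p.2 ord0) p.1 (unlift ord0 i).

Definition uncons_rV (v : 'rV[R]_n.+1) : measurableTypeR R * 'rV[R]_n :=
  (v ord0 ord0, \row_j v ord0 (lift ord0 j)).

Lemma cons_rVK : cancel cons_rV uncons_rV.
Proof.
move=> [x v]; rewrite /uncons_rV /cons_rV mxE unlift_none /=; congr pair.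
by apply/rowP => j; rewrite !mxE liftK.
Qed.

Lemma measurable_cons_rV : measurable_fun setT cons_rV.
Proof.
apply: measurable_fun_rVP => i.
have [j ->|->] := unliftP ord0 i.
  rewrite (_ : (fun _ => _) = (fun v : 'rV[R]_n => v ord0 j) \o snd).
    apply: (@measurableT_comp _ _ _ _ _ (measurableTypeR R)) => //.
    exact: measurable_coord.
  by apply/funext => p /=; rewrite mxE liftK.
rewrite (_ : (fun _ => _) = fst) //.
by apply/funext => p /=; rewrite mxE unlift_none.
Qed.

Lemma measurable_uncons_rV : measurable_fun setT uncons_rV.
Proof.
have mtail : measurable_fun setT
    (fun v : 'rV[R]_n.+1 => \row_j v ord0 (lift ord0 j) : 'rV[R]_n).
  apply: (@measurable_fun_rVP R n) => i.
  rewrite (_ : (fun _ => _) = fun v : 'rV[R]_n.+1 => v ord0 (lift ord0 i)).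
    exact: measurable_coord.
  by apply/funext => v; rewrite mxE.
exact: measurable_fun_pair (measurable_coord ord0) mtail.
Qed.

End cons_rV.

Section lebesgue_rV_step.
Variables (R : realType) (n : nat).
Variable mu : {sigma_finite_measure set 'rV[R]_n -> \bar R}.
Local Open Scope ereal_scope.

Definition lebesgue_rV_step : set 'rV[R]_n.+1 -> \bar R :=
  pushforward (@lebesgue_measure R \x mu) (@cons_rV R n).

Let step0 : lebesgue_rV_step set0 = 0.
Proof. by rewrite /lebesgue_rV_step /pushforward preimage_set0 measure0. Qed.

Let step_ge0 A : 0 <= lebesgue_rV_step A.
Proof. by rewrite /lebesgue_rV_step /pushforward measure_ge0. Qed.

Let step_sigma_additive : semi_sigma_additive lebesgue_rV_step.
Proof.
move=> F mF tF mUF; rewrite /lebesgue_rV_step /pushforward preimage_bigcup.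
have mcons := @measurable_cons_rV R n.
apply: measure_semi_sigma_additive.
- by move=> i; rewrite -[X in measurable X]setTI; exact: mcons.
- apply/trivIsetP => /= i j _ _ ij; rewrite -preimage_setI.
  by move/trivIsetP : tF => /(_ _ _ _ _ ij) ->//; rewrite preimage_set0.
- by rewrite -preimage_bigcup -[X in measurable X]setTI; exact: mcons.
Qed.

HB.instance Definition _ := isMeasure.Build _ _ _ lebesgue_rV_step
  step0 step_ge0 step_sigma_additive.

Let step_sigma_finite : sigma_finite setT lebesgue_rV_step.
Proof.
have /sigma_finiteP[F [TF ndF Foo]] := sigma_finiteT (@lebesgue_measure R).
have /sigma_finiteP[G [TG ndG Goo]] := sigma_finiteT mu.
exists (fun k => @uncons_rV R n @^-1` (F k `*` G k)).
  apply/esym; rewrite -subTset => v _.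
  have [i _ Fi] : (\bigcup_k F k) (uncons_rV v).1 by rewrite -TF.
  have [j _ Gj] : (\bigcup_k G k) (uncons_rV v).2 by rewrite -TG.
  exists (maxn i j) => //; split.
  - by move: Fi; exact/subsetPset/ndF/leq_maxl.
  - by move: Gj; exact/subsetPset/ndG/leq_maxr.
move=> k; have [mF Fk] := Foo k; have [mG Gk] := Goo k; split.
  rewrite -[X in measurable X]setTI; apply: measurable_uncons_rV => //.
  exact: measurableX.
rewrite /lebesgue_rV_step /pushforward (_ : _ @^-1` _ = F k `*` G k).
  by rewrite product_measure1E// lte_mul_pinfty// ge0_fin_numE.
by apply/seteqP; split => p; rewrite /preimage /mkset cons_rVK.
Qed.

HB.instance Definition _ := Measure_isSigmaFinite.Build _ _ _
  lebesgue_rV_step step_sigma_finite.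

End lebesgue_rV_step.

(* In dimension [0], [R^0] is a single point, of mass [1]. *)
Fixpoint lebesgue_rV (R : realType) (n : nat) :
    {sigma_finite_measure set 'rV[R]_n -> \bar R} :=
  match n with
  | 0 => \d_(0 : 'rV[R]_0)
  | n'.+1 => lebesgue_rV_step (lebesgue_rV R n')
  end.

Lemma lebesgue_rV_box (R : realType) (n : nat)
    (A : 'I_n -> set (measurableTypeR R)) : (forall i, measurable (A i)) ->
  lebesgue_rV R n [set v | forall i, A i (v ord0 i)] =
  (\prod_(i < n) lebesgue_measure (A i))%E.
Proof.
elim: n A => [|n IH] A mA.
  rewrite big_ord0 /= /dirac indicE mem_set//.
  by case.
rewrite big_ord_recl -IH; last by move=> i; exact: mA.
rewrite /= /lebesgue_rV_step /pushforward.
rewrite (_ : _ @^-1` _ = A ord0 `*`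
  [set v : 'rV[R]_n | forall i, A (lift ord0 i) (v ord0 i)]).
  rewrite product_measure1E//.
  rewrite (_ : mkset _ = \bigcap_(i in [set: 'I_n])
    ((fun v : 'rV[R]_n => v ord0 i) @^-1` A (lift ord0 i))).
    apply: fin_bigcap_measurable => // i _.
    by rewrite -[X in measurable X]setTI; exact: measurable_coord.
  by apply/seteqP; split => v /=; [move=> h i _; exact: h|move=> h i; exact: h].
apply/seteqP; split => [[x v]/= h|[x v]/= [h0 h] i].
  split; first by have := h ord0; rewrite mxE unlift_none.
  by move=> i; have := h (lift ord0 i); rewrite mxE liftK.
by rewrite mxE; case: unliftP => [j ->|->]; [exact: h|].
Qed.

(* [`|x|] on ['rV[R]_n] is the sup norm, hence this definition. *)
Definition enorm (R : realType) n (x : 'rV[R]_n) : R :=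
  Num.sqrt (\sum_i x ord0 i ^+ 2).

Section random_vectors.
Context d (T : measurableType d) d' (T' : measurableType d') (R : realType).
Variable P : probability T R.

Definition same_distribution (X Y : {RV P >-> T'}) :=
  forall A : set T', measurable A -> distribution P X A = distribution P Y A.

(* Mutual independence of a finite family: the product rule for a subfamily is
   the case where the remaining events are [setT]. *)
Definition independent_RVs (I : finType) (X : I -> {RV P >-> T'}) :=
  forall A : I -> set T', (forall i, measurable (A i)) ->
    P (\bigcap_(i in [set: I]) (X i @^-1` A i)) =
    (\prod_(i : I) P (X i @^-1` A i))%E.

Definition independent_copies (I : finType) (X : {RV P >-> T'})
    (Y : I -> {RV P >-> T'}) :=
  (forall i, same_distribution (Y i) X) /\ independent_RVs Y.

End random_vectors.

Definition has_density d (T : measurableType d) (R : realType)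
    (P : probability T R) n (X : {RV P >-> 'rV[R]_n}) (p : 'rV[R]_n -> R) :=
  [/\ forall x, 0 <= p x,
      measurable_fun setT (p : 'rV[R]_n -> measurableTypeR R) &
      forall A, measurable A ->
        distribution P X A = (\int[lebesgue_rV R n]_(x in A) (p x)%:E)%E].

Section kernel_density.
Variables (R : realType) (nu N : nat).

(* Silverman's rule, for a random vector with unit covariance. *)
Definition bandwidth : R :=
  (4 / (N%:R * (nu%:R + 2))) `^ (nu%:R + 4)^-1.

Definition bandwidth_hat : R :=
  bandwidth / Num.sqrt (bandwidth ^+ 2 + (N%:R - 1) / N%:R).

Definition gauss_kernel (eta : 'rV[R]_nu) : R :=
  ((Num.sqrt (2 * pi) * bandwidth_hat) ^+ nu)^-1 *
  expR (- (2 * bandwidth_hat ^+ 2)^-1 * enorm eta ^+ 2).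

Definition density_estimator d (T : measurableType d) (P : probability T R)
    (Y : 'I_N -> {RV P >-> 'rV[R]_nu}) (eta : 'rV[R]_nu) (w : T) : R :=
  N%:R^-1 *
  \sum_(j < N) gauss_kernel ((bandwidth_hat / bandwidth) *: Y j w - eta).

End kernel_density.

(* Main.v *)
From HB Require Import structures.
Require Import Defs.
From mathcomp Require Import all_boot all_order all_algebra.
From mathcomp Require Import all_classical all_reals all_analysis.
From mathcomp Require Import measurable_realfun ring.

Import Order.TTheory GRing.Theory Num.Theory.
Import numFieldNormedType.Exports.

Local Open Scope classical_set_scope.
Local Open Scope ring_scope.

Set Implicit Arguments.
Unset Strict Implicit.

(** The estimator is an average of [N] independent variables [k(Y_j)], and the
    rescaling by [bandwidth_hat / bandwidth] turns its kernel into a multiple of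
    a normal density: with [c = bandwidth / bandwidth_hat] ([shrinkage] below),
    [k] is [c ^ nu] times the isotropic normal density of mean [c *: eta] and
    standard deviation [bandwidth] ([gauss_kernelE]). As [N] grows the bandwidth
    tends to [0] and [c] tends to [1].

    Mean. The expectation is therefore [c ^ nu] times the integral of [pH]
    against a normal law that concentrates at [eta]. The density [pH] is
    continuous but may be unbounded, so no constant dominates its translates.
    Near the mean [pH] is within [e] of [pH eta]; far from it, the mass
    of [pH] itself is [1] and the normal density is uniformly small
    ([gauss_rV_far]), while the mass that the normal law puts there is small
    because its density is dominated by a small multiple of the normal density
    with doubled variance ([gauss_rV_far_dilate]). Integrating these pointwise
    bounds gives [gauss_rV_mean_le], [gauss_rV_mean_ge], and then
    [gauss_rV_mean_cvg].

    Variance. By independence the variances of the terms add up. A variable with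
    values in [[0, M]] has variance at most [M] times its mean, so the average
    has variance at most [M / N] times its mean
    ([variance_independent_average]). Here [M] is the value of the kernel at
    [0], and [variance_const] is the factor that makes [M / N] equal to
    [N `^ (- (4 / (nu + 4)))] times it. Its closed form ([variance_constE]) is
    the announced limit times [c ^ nu]. *)

(** * Normal densities on R^n *)

(** Tonelli, one coordinate at a time. *)
Lemma integral_rV_prod (R : realType) (n : nat) (f : 'I_n -> R -> R) :
  (forall i, measurable_fun setT (f i)) -> (forall i x, 0 <= f i x) ->
  (\int[lebesgue_rV R n]_v (\prod_(i < n) f i (v ord0 i))%:E =
   \prod_(i < n) \int[@lebesgue_measure R]_x (f i x)%:E)%E.
Proof.
elim: n f => [|n IH] f mf f0.
  rewrite big_ord0 /=.
  under eq_integral do rewrite big_ord0.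
  by rewrite integral_cst//= diracT mule1.
have mprod m (g : 'I_m -> R -> R) : (forall i, measurable_fun setT (g i)) ->
    measurable_fun setT (fun v : 'rV[R]_m => \prod_(i < m) g i (v ord0 i)).
  move=> mg; apply: measurable_prod => i _.
  exact: (measurableT_comp (mg i) (measurable_coord i)).
rewrite big_ord_recl -IH//= ge0_integral_pushforward//; last 3 first.
- exact: measurable_cons_rV.
- by apply/measurable_EFinP; exact: mprod.
- by move=> v _; rewrite lee_fin prodr_ge0.
rewrite preimage_setT.
pose F (p : measurableTypeR R * 'rV[R]_n) :=
  ((f ord0 p.1)%:E * (\prod_(i < n) f (lift ord0 i) (p.2 ord0 i))%:E)%E.
transitivity (\int[@lebesgue_measure R \x lebesgue_rV R n]_p F p)%E.
  apply: eq_integral.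
  move=> -[x v] _; rewrite /F /= big_ord_recl EFinM !mxE unlift_none /=.
  congr (_ * _%:E)%E; apply: eq_bigr => i _.
  by rewrite mxE liftK.
have F0 p : (0 <= F p)%E.
  by rewrite /F mule_ge0// lee_fin// prodr_ge0.
have mg : measurable_fun setT
    (fun v : 'rV[R]_n => (\prod_(i < n) f (lift ord0 i) (v ord0 i))%:E).
  by apply/measurable_EFinP; apply: (mprod _ (fun i => f (lift ord0 i))).
have mF : measurable_fun setT F.
  apply: emeasurable_funM.
    by apply/measurable_EFinP/(measurableT_comp (mf ord0)).
  exact: (measurableT_comp mg).
rewrite fubini_tonelli1//.
under eq_integral => x _.
  rewrite /fubini_F /F /= ge0_integralZl//; last 2 first.
  - by move=> v _; rewrite lee_fin prodr_ge0.
  - by rewrite lee_fin.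
  over.
rewrite ge0_integralZr//.
- by apply/measurable_EFinP; exact: mf.
- by move=> x _; rewrite lee_fin.
- by apply: integral_ge0 => v _; rewrite lee_fin prodr_ge0.
Qed.

(** The density of the isotropic normal law on R^n with mean [a] and variance
    [s ^+ 2] in each coordinate. *)
Definition gauss_rV (R : realType) n (a : 'rV[R]_n) (s : R) (x : 'rV[R]_n) :=
  ((Num.sqrt (2 * pi) * s) ^+ n)^-1 *
  expR (- (2 * s ^+ 2)^-1 * enorm (x - a) ^+ 2).

Section gauss_rV_lemmas.
Variables (R : realType) (n : nat).
Implicit Types (a x : 'rV[R]_n) (s : R).

Lemma enorm_sqr x : enorm x ^+ 2 = \sum_i x ord0 i ^+ 2.
Proof. by rewrite sqr_sqrtr// sumr_ge0// => i _; exact: sqr_ge0. Qed.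

Lemma gauss_rV_prod a s x : 0 < s ->
  gauss_rV a s x = \prod_(i < n) normal_pdf (a ord0 i) s (x ord0 i).
Proof.
move=> s0; rewrite /gauss_rV enorm_sqr.
under [RHS]eq_bigr do rewrite normal_pdfE ?gt_eqF//.
rewrite big_split /= prodr_const card_ord /normal_fun -expR_sum mulr_sumr.
congr (_ * expR _).
  rewrite -exprVn /normal_peak; congr (_^-1 ^+ _).
  rewrite (_ : s ^+ 2 * pi *+ 2 = 2 * pi * s ^+ 2); last by ring.
  by rewrite [RHS]sqrtrM ?mulr_ge0 ?pi_ge0// sqrtr_sqr gtr0_norm.
by apply: eq_bigr => i _; rewrite !mxE -(mulr_natl (s ^+ 2)); ring.
Qed.

Lemma gauss_rV_ge0 a s x : 0 <= s -> 0 <= gauss_rV a s x.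
Proof.
move=> s0; rewrite mulr_ge0 ?expR_ge0// invr_ge0 exprn_ge0// mulr_ge0//.
Qed.

Lemma measurable_gauss_rV a s : measurable_fun setT (gauss_rV a s).
Proof.
apply: measurable_funM => //; apply: measurableT_comp => //.
apply: measurable_funM => //.
rewrite (_ : (fun _ => _) =
    fun x : 'rV[R]_n => \sum_i (x ord0 i - a ord0 i) ^+ 2).
  apply: measurable_sum => i; apply: measurable_funX.
  apply: measurable_funB => //.
  exact: measurable_coord.
by apply/funext => x; rewrite enorm_sqr; apply: eq_bigr => i _; rewrite !mxE.
Qed.

Lemma integral_gauss_rV a s : 0 < s ->
  (\int[lebesgue_rV R n]_x (gauss_rV a s x)%:E = 1)%E.
Proof.
move=> s0; under eq_integral do rewrite gauss_rV_prod//.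
rewrite (@integral_rV_prod _ _ (fun i => normal_pdf (a ord0 i) s)).
- by rewrite big1// => i _; exact: integral_normal_pdf.
- by move=> i; exact: measurable_normal_pdf.
- by move=> i x; exact: normal_pdf_ge0.
Qed.

End gauss_rV_lemmas.

Lemma cvg_expr_seq (R : realType) (u : nat -> R) (l : R) m :
  u @ \oo --> l -> u k ^+ m @[k --> \oo] --> l ^+ m.
Proof.
move=> ul; apply: (cvg_trans _ (@exprn_continuous R m l)).
exact: (cvg_app (fun x : R => x ^+ m) ul).
Qed.

Lemma cvg_cst_expr0 (R : realType) (c : R) m (u : nat -> R) :
  u @ \oo --> 0 -> c * u k ^+ m.+1 @[k --> \oo] --> 0.
Proof.
move=> u0; rewrite -[X in _ --> X](mulr0 c) -[X in _ * X](@expr0n R m.+1).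
by apply: cvgMl_tmp; exact: cvg_expr_seq.
Qed.

Section gauss_rV_bounds.
Variables (R : realType) (n : nat).
Implicit Types (a x : 'rV[R]_n) (s r : R).

Lemma coord_le_enorm x i : `|x ord0 i| <= enorm x.
Proof.
rewrite -sqrtr_sqr ler_sqrt ?sumr_ge0// => [|j _]; last exact: sqr_ge0.
by rewrite (bigD1 i)//= lerDl sumr_ge0// => j _; exact: sqr_ge0.
Qed.

(** From [expR (- y) <= m!/y ^ m] with [y] of order [s ^- 2]: the exponent
    [m = n.+1] is large enough to beat the normalization [s ^- n] and to leave a
    bound that tends to [0] with [s]. *)
Lemma gauss_rV_far a s x r : 0 < s -> 0 < r -> r <= enorm (x - a) ->
  gauss_rV a s x <=
  (Num.sqrt (2 * pi) ^+ n)^-1 * (n.+1`!%:R * (2 / r ^+ 2) ^+ n.+1) *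
  s ^+ n.+2.
Proof.
move=> s0 r0 rx; rewrite /gauss_rV.
set y := (2 * s ^+ 2)^-1 * r ^+ 2.
have y0 : 0 < y by rewrite mulr_gt0 ?invr_gt0 ?exprn_gt0 ?mulr_gt0.
have yE : expR (- (2 * s ^+ 2)^-1 * enorm (x - a) ^+ 2) <=
    n.+1`!%:R / y ^+ n.+1.
  apply: (@le_trans _ _ (expR (- y))).
    rewrite ler_expR mulNr lerN2 /y ler_wpM2l ?invr_ge0 ?mulr_ge0 ?(ltW s0)//.
    by rewrite ler_sqr ?nnegrE ?(ltW r0)// ?(le_trans (ltW r0) rx).
  rewrite expRN -[leRHS]invf_div lef_pV2 ?posrE ?expR_gt0
    ?divr_gt0 ?exprn_gt0 ?ltr0n ?fact_gt0//.
  by apply: le_trans (expR_ge1Dxn n (ltW y0)); rewrite lerDr.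
have c0 : 0 < Num.sqrt (2 * pi : R) by rewrite sqrtr_gt0 mulr_gt0 ?pi_gt0.
apply: (@le_trans _ _ (((Num.sqrt (2 * pi) * s) ^+ n)^-1 *
    (n.+1`!%:R / y ^+ n.+1))).
  by rewrite ler_wpM2l// invr_ge0 exprn_ge0// mulr_ge0 ?ltW.
rewrite le_eqVlt; apply/orP; left; apply/eqP.
have -> : (y ^+ n.+1)^-1 = (2 / r ^+ 2) ^+ n.+1 * (s ^+ n * s ^+ n.+2).
  rewrite -exprD -exprVn /y.
  have -> : ((2 * s ^+ 2)^-1 * r ^+ 2)^-1 = 2 / r ^+ 2 * s ^+ 2.
    by field; rewrite !gt_eqF.
  by rewrite exprMn -exprM mul2n -addnn addSnnS.
rewrite !exprMn; field.
by rewrite !expf_neq0 ?gt_eqF.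
Qed.

(** A uniform bound is of no use for integrating over a set of infinite volume.
    Doubling the variance absorbs half of the exponent, and the other half is
    small as soon as [x] is far from [a]. *)
Lemma gauss_rV_far_dilate a s x r : 0 < s -> 0 < r -> r <= enorm (x - a) ->
  gauss_rV a s x <=
  (4 / r ^+ 2 * Num.sqrt 2 ^+ n) * s ^+ 2 * gauss_rV a (Num.sqrt 2 * s) x.
Proof.
move=> s0 r0 rx; rewrite /gauss_rV.
have c0 : 0 < Num.sqrt (2 * pi : R) by rewrite sqrtr_gt0 mulr_gt0 ?pi_gt0.
have d0 : 0 < Num.sqrt (2 : R) by rewrite sqrtr_gt0.
have r20 : 0 < r ^+ 2 by rewrite exprn_gt0.
have s20 : 0 < s ^+ 2 by rewrite exprn_gt0.
set q := enorm (x - a) ^+ 2.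
have rq : r ^+ 2 <= q.
  by rewrite ler_sqr ?nnegrE ?(ltW r0)// ?(le_trans (ltW r0) rx).
rewrite (_ : - (2 * s ^+ 2)^-1 * q =
  - (2 * (Num.sqrt 2 * s) ^+ 2)^-1 * q - (4 * s ^+ 2)^-1 * q); last first.
  by rewrite exprMn sqr_sqrtr//; field; rewrite gt_eqF.
rewrite expRD [leRHS](_ : _ = ((Num.sqrt (2 * pi) * s) ^+ n)^-1 *
    expR (- (2 * (Num.sqrt 2 * s) ^+ 2)^-1 * q) *
    (4 / r ^+ 2 * s ^+ 2)); last first.
  rewrite !exprMn; field.
  by rewrite !expf_neq0 ?gt_eqF// expf_neq0 ?gt_eqF.
rewrite [leLHS]mulrA ler_wpM2l ?mulr_ge0 ?expR_ge0 ?invr_ge0 ?exprn_ge0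
  ?mulr_ge0 ?(ltW s0)//.
set y := (4 * s ^+ 2)^-1 * q.
have yr : (4 / r ^+ 2 * s ^+ 2)^-1 <= y.
  have -> : (4 / r ^+ 2 * s ^+ 2)^-1 = (4 * s ^+ 2)^-1 * r ^+ 2.
    by field; rewrite !gt_eqF.
  by rewrite ler_wpM2l// invr_ge0 mulr_ge0 ?(ltW s20).
rewrite expRN invf_ple ?posrE ?expR_gt0 ?mulr_gt0 ?invr_gt0//.
apply: (le_trans yr); apply: le_trans (expR_ge1Dx y).
by rewrite lerDr.
Qed.
End gauss_rV_bounds.

(** * Concentrating normal averages of an unbounded density *)

Section gauss_rV_mean.
Variables (R : realType) (n : nat) (p : 'rV[R]_n -> R).
Hypotheses (p0 : forall x, 0 <= p x) (mp : measurable_fun setT p).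
Hypothesis intp : (\int[lebesgue_rV R n]_x (p x)%:E = 1)%E.

Implicit Types (a : 'rV[R]_n) (s r v e : R).

Let mean a s : \bar R := (\int[lebesgue_rV R n]_x (gauss_rV a s x * p x)%:E)%E.

Let C (r : R) := (Num.sqrt (2 * pi) ^+ n)^-1 *
  (n.+1`!%:R * (2 / r ^+ 2) ^+ n.+1).
Let D (r : R) := 4 / r ^+ 2 * Num.sqrt 2 ^+ n.

Let C_ge0 r : 0 <= C r.
Proof.
by rewrite !mulr_ge0 ?invr_ge0 ?exprn_ge0 ?sqrtr_ge0// divr_ge0 ?sqr_ge0.
Qed.

Let D_ge0 r : 0 <= D r.
Proof.
by rewrite mulr_ge0 ?exprn_ge0 ?sqrtr_ge0// divr_ge0 ?sqr_ge0.
Qed.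

Let integral_comb (c c' : R) (f g : 'rV[R]_n -> R) :
  0 <= c -> 0 <= c' -> measurable_fun setT f -> measurable_fun setT g ->
  (forall x, 0 <= f x) -> (forall x, 0 <= g x) ->
  (\int[lebesgue_rV R n]_x (c * f x + c' * g x)%:E =
   c%:E * \int[lebesgue_rV R n]_x (f x)%:E +
   c'%:E * \int[lebesgue_rV R n]_x (g x)%:E)%E.
Proof.
move=> c0 c'0 mf mg f0 g0.
under eq_integral do rewrite EFinD !EFinM.
rewrite ge0_integralD//=; last 4 first.
- by move=> x _; rewrite mule_ge0 ?lee_fin.
- by apply: emeasurable_funM => //; apply/measurable_EFinP.
- by move=> x _; rewrite mule_ge0 ?lee_fin.
- by apply: emeasurable_funM => //; apply/measurable_EFinP.
have Zl (k : R) (h : 'rV[R]_n -> R) : 0 <= k ->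
    measurable_fun setT h -> (forall x, 0 <= h x) ->
    (\int[lebesgue_rV R n]_x (k%:E * (h x)%:E) =
     k%:E * \int[lebesgue_rV R n]_x (h x)%:E)%E.
  move=> k0 mh h0; rewrite ge0_integralZl//; first exact/measurable_EFinP.
  by move=> x _; rewrite lee_fin.
by rewrite !Zl.
Qed.

Let mgauss a s : measurable_fun setT (gauss_rV a s : 'rV[R]_n -> R).
Proof. exact: measurable_gauss_rV. Qed.

Let mgaussp a s : measurable_fun setT (fun x => gauss_rV a s x * p x).
Proof. exact: measurable_funM. Qed.

(** The far part costs [C r * s ^+ n.+2] because [p] has total mass [1], however
    large its values are. *)
Lemma gauss_rV_mean_le a s r v e : 0 < s -> 0 < r -> 0 <= v -> 0 <= e ->
  (forall x, enorm (x - a) < r -> `|p x - v| <= e) ->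
  (mean a s <= (v + e + C r * s ^+ n.+2)%:E)%E.
Proof.
move=> s0 r0 v0 e0 pv.
have K0 : 0 <= C r * s ^+ n.+2 by rewrite mulr_ge0// exprn_ge0// ltW.
have g0 x : 0 <= gauss_rV a s x by rewrite gauss_rV_ge0// ltW.
apply: (@le_trans _ _ (\int[lebesgue_rV R n]_x
    ((v + e) * gauss_rV a s x + C r * s ^+ n.+2 * p x)%:E)%E).
  apply: ge0_le_integral => //.
  - by move=> x _; rewrite lee_fin mulr_ge0.
  - exact/measurable_EFinP.
  - apply/measurable_EFinP; apply: measurable_funD; exact: measurable_funM.
  - move=> x _; rewrite lee_fin; have [xr|xr] := ltP (enorm (x - a)) r.
      rewrite -[leLHS]addr0 lerD ?(mulr_ge0 K0)// mulrC ler_wpM2r//.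
      by have := pv _ xr; rewrite ler_distl => /andP[].
    rewrite -[leLHS]add0r lerD ?(mulr_ge0 (addr_ge0 v0 e0))//.
    by rewrite ler_wpM2r//; exact: gauss_rV_far.
rewrite integral_comb// ?addr_ge0//.
by rewrite integral_gauss_rV// intp !mule1 -EFinD.
Qed.

(** Here the far part is a mass of the normal law, not of [p]; the dilated
    density has integral [1] and makes it [O(s ^+ 2)]. *)
Lemma gauss_rV_mean_ge a s r v e : 0 < s -> 0 < r -> 0 <= v -> 0 <= e ->
  (forall x, enorm (x - a) < r -> `|p x - v| <= e) ->
  (v%:E <= mean a s + (e + v * D r * s ^+ 2)%:E)%E.
Proof.
move=> s0 r0 v0 e0 pv.
have s20 : 0 < Num.sqrt 2 * s by rewrite mulr_gt0.
have g0 x : 0 <= gauss_rV a s x by rewrite gauss_rV_ge0// ltW.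
have h0 x : 0 <= gauss_rV a (Num.sqrt 2 * s) x by rewrite gauss_rV_ge0// ltW.
have K0 : 0 <= D r * s ^+ 2 by rewrite mulr_ge0// exprn_ge0// ltW.
have -> : (v%:E = \int[lebesgue_rV R n]_x (v * gauss_rV a s x)%:E)%E.
  under eq_integral do rewrite EFinM.
  rewrite ge0_integralZl//; last 2 first.
  - exact/measurable_EFinP.
  - by move=> x _; rewrite lee_fin.
  by rewrite integral_gauss_rV// mule1.
apply: (@le_trans _ _ (\int[lebesgue_rV R n]_x
    (1 * (gauss_rV a s x * p x) + 1 * (e * gauss_rV a s x +
       v * (D r * s ^+ 2) * gauss_rV a (Num.sqrt 2 * s) x))%:E)%E).
  apply: ge0_le_integral => //.
  - by move=> x _; rewrite lee_fin mulr_ge0.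
  - by apply/measurable_EFinP; exact: measurable_funM.
  - apply/measurable_EFinP.
    apply: measurable_funD; apply: measurable_funM => //.
    by apply: measurable_funD; exact: measurable_funM.
  - move=> x _; rewrite lee_fin !mul1r; have [xr|xr] := ltP (enorm (x - a)) r.
      rewrite addrA -[leLHS]addr0 lerD ?(mulr_ge0 (mulr_ge0 v0 K0))//.
      rewrite (mulrC (gauss_rV _ _ _)) -mulrDl ler_wpM2r//.
      by have := pv _ xr; rewrite distrC ler_distl => /andP[].
    rewrite -[leLHS]add0r lerD ?(mulr_ge0 (g0 x))//.
    rewrite -[leLHS]add0r lerD ?(mulr_ge0 e0)// -mulrA ler_wpM2l//.
    exact: gauss_rV_far_dilate.
rewrite integral_comb//; last 3 first.
- by apply: measurable_funD; exact: measurable_funM.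
- by move=> x; rewrite mulr_ge0.
- by move=> x; exact: addr_ge0 (mulr_ge0 e0 _) (mulr_ge0 (mulr_ge0 v0 K0) _).
rewrite integral_comb// ?(mulr_ge0 v0 K0)//.
by rewrite !integral_gauss_rV// !mul1e !mule1 -EFinD mulrA.
Qed.

(** The radius [d / 2] leaves room for the drift of the centers [a k], which are
    eventually within [d / 2] of [eta]. *)
Lemma gauss_rV_mean_cvg (a : nat -> 'rV[R]_n) (s : nat -> R) (eta : 'rV[R]_n) :
  {for eta, continuous p} ->
  (forall i, a k ord0 i @[k --> \oo] --> eta ord0 i) ->
  (\forall k \near \oo, 0 < s k) -> s @ \oo --> 0 ->
  mean (a k) (s k) @[k --> \oo] --> (p eta)%:E.
Proof.
move=> cp ca s0 cs.
have bounds e : 0 < e -> \forall k \near \oo,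
    ((mean (a k) (s k) <= (p eta + e)%:E) /\
     ((p eta)%:E <= mean (a k) (s k) + e%:E))%E.
  move=> e0; have e20 : 0 < e / 2 by rewrite divr_gt0.
  have /nbhs_ballP[d /= d0 pd] : nbhs eta [set x | `|p x - p eta| <= e / 2].
    by move/cvgrPdist_le : cp => /(_ _ e20); apply: filterS => x;
      rewrite distrC.
  have d20 : 0 < d / 2 by rewrite divr_gt0.
  have an : \forall k \near \oo, forall i, `|eta ord0 i - a k ord0 i| < d / 2.
    apply: filter_forall => i.
    by have /cvgrPdist_lt/(_ _ d20) := ca i.
  have cC := cvg_cst_expr0 (C (d / 2)) n.+1 cs.
  have cD := cvg_cst_expr0 (p eta * D (d / 2)) 1 cs.
  near=> k.
  have sk : 0 < s k by near: k.
  have eta_a : forall i, `|eta ord0 i - a k ord0 i| < d / 2 by near: k.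
  have Ck : C (d / 2) * s k ^+ n.+2 < e / 2.
    by near: k; move/cvgrPdist_lt : cC => /(_ _ e20); apply: filterS => k;
      rewrite sub0r normrN; exact/le_lt_trans/ler_norm.
  have Dk : p eta * D (d / 2) * s k ^+ 2 < e / 2.
    by near: k; move/cvgrPdist_lt : cD => /(_ _ e20); apply: filterS => k;
      rewrite sub0r normrN; exact/le_lt_trans/ler_norm.
  have pk x : enorm (x - a k) < d / 2 -> `|p x - p eta| <= e / 2.
    move=> xk; apply: pd; split => // i j; rewrite ord1 /ball /=.
    have xi : `|a k ord0 j - x ord0 j| < d / 2.
      by have := coord_le_enorm (x - a k) j; rewrite !mxE distrC =>
        /le_lt_trans->.
    rewrite (splitr d) (le_lt_trans _ (ltrD (eta_a j) xi))//.
    by rewrite (le_trans _ (ler_normD _ _))// addrA subrK.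
  split.
    apply: le_trans (gauss_rV_mean_le sk d20 (p0 eta) (ltW e20) pk) _.
    by rewrite lee_fin [in leRHS](splitr e) addrA lerD2l ltW.
  apply: le_trans (gauss_rV_mean_ge sk d20 (p0 eta) (ltW e20) pk) _.
  by rewrite leeD2l// lee_fin [leRHS](splitr e) lerD2l ltW.
have mean_fin : \forall k \near \oo, mean (a k) (s k) \is a fin_num.
  near=> k.
  have [le_k _] : (mean (a k) (s k) <= (p eta + 1)%:E)%E /\
     ((p eta)%:E <= mean (a k) (s k) + 1%:E)%E by near: k; exact: bounds.
  have sk : 0 < s k by near: k.
  rewrite ge0_fin_numE ?(le_lt_trans le_k) ?ltry//.
  by apply: integral_ge0 => x _; rewrite lee_fin mulr_ge0// gauss_rV_ge0// ltW.
apply/fine_cvgP; split => //.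
apply/cvgrPdist_le => e e0.
near=> k.
have [] : (mean (a k) (s k) <= (p eta + e)%:E)%E /\
     ((p eta)%:E <= mean (a k) (s k) + e%:E)%E by near: k; exact: bounds.
have mk : mean (a k) (s k) \is a fin_num by near: k.
rewrite -(fineK mk) -EFinD !lee_fin /= => h1 h2.
by rewrite ler_distl h2 lerBlDr h1.
Unshelve. all: end_near.
Qed.

End gauss_rV_mean.

(** * Densities, independence and variance *)

(** The density agrees almost everywhere with the Radon-Nikodym derivative, for
    which the change of variables is known. *)
Lemma integral_density d (T : measurableType d) (R : realType)
    (nu : {finite_measure set T -> \bar R})
    (mu : {sigma_finite_measure set T -> \bar R}) (p f : T -> \bar R) :
  measurable_fun setT p ->
  (forall A, measurable A -> nu A = \int[mu]_(x in A) p x)%E ->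
  nu.-integrable setT f ->
  (\int[nu]_x f x = \int[mu]_x (f x * p x))%E.
Proof.
move=> mp nup intf.
have numu : nu `<< mu.
  apply/null_content_dominatesP => A mA muA; rewrite nup//.
  by apply: null_set_integral => //; exact: measurable_funTS.
have intRN := Radon_Nikodym_integrable
  (numu : charge_of_finite_measure nu `<< mu).
have RNp : ae_eq mu setT (Radon_Nikodym (charge_of_finite_measure nu) mu) p.
  apply: integral_ae_eq => // A _ mA.
  by rewrite -Radon_Nikodym_integral// -nup.
rewrite -(Radon_Nikodym_change_of_variables numu)//.
have mf := measurable_int _ intf.
apply: ae_eq_integral => //.
- by apply: emeasurable_funM => //; exact: measurable_int intRN.
- exact: emeasurable_funM.
- exact: ae_eqe_mul2l.
Qed.

Section independence.
Context d (T : measurableType d) d' (T' : measurableType d') (R : realType).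
Variables (P : probability T R) (I : finType) (Y : I -> {RV P >-> T'}).
Hypothesis indepY : independent_RVs Y.

Lemma independent_RVs_pair i j A B : i != j -> measurable A -> measurable B ->
  P (Y i @^-1` A `&` Y j @^-1` B) = (P (Y i @^-1` A) * P (Y j @^-1` B))%E.
Proof.
move=> ij mA mB.
pose F k := if k == i then A else if k == j then B else setT.
have Fi : F i = A by rewrite /F eqxx.
have Fj : F j = B by rewrite /F eq_sym (negbTE ij) eqxx.
have mF k : measurable (F k) by rewrite /F; case: ifP => // _; case: ifP.
have := indepY mF; rewrite (bigD1 i)//= (bigD1 j) 1?eq_sym//= big1 => [|k].
  rewrite mule1 Fi Fj => <-; congr (P _); apply/seteqP; split => w /=.
    by move=> [Aw Bw] k _; rewrite /F; case: eqP => [->//|_];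
      case: eqP => [->//|].
  by move=> YF; split; [rewrite -Fi|rewrite -Fj]; exact: YF.
move=> /andP[ki kj]; rewrite /F (negbTE ki) (negbTE kj) preimage_setT.
exact: probability_setT.
Qed.

(** The law of the pair [(Y i, Y j)] agrees with the product of the two laws on
    rectangles, hence everywhere; then Tonelli. *)
Lemma independent_RVs_expectationM i j (f g : T' -> \bar R) : i != j ->
  measurable_fun setT f -> measurable_fun setT g ->
  (forall x, 0 <= f x)%E -> (forall x, 0 <= g x)%E ->
  (\int[P]_w (f (Y i w) * g (Y j w)) =
   \int[P]_w f (Y i w) * \int[P]_w g (Y j w))%E.
Proof.
move=> ij mf mg f0 g0.
pose Z w := (Y i w, Y j w).
have mZ : measurable_fun setT Z by apply: measurable_fun_pair.
pose h (z : T' * T') := (f z.1 * g z.2)%E.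
have h0 z : (0 <= h z)%E by rewrite mule_ge0.
have mh : measurable_fun setT h.
  by apply: emeasurable_funM; exact: measurableT_comp.
pose ZRV : {RV P >-> (T' * T')%type} :=
  HB.pack Z (isMeasurableFun.Build _ _ _ _ Z mZ).
transitivity (\int[distribution P ZRV]_z h z)%E.
  by rewrite ge0_integral_distribution.
rewrite -(eq_measure_integral (distribution P ZRV)
  (m1 := (distribution P (Y i) \x distribution P (Y j))%E)); last first.
  move=> A mA _; apply: product_measure_unique => // B C mB mC.
  exact: independent_RVs_pair.
rewrite fubini_tonelli1//.
have g0i : (0 <= \int[distribution P (Y j)]_y g y)%E by exact: integral_ge0.
under eq_integral => x _.
  rewrite /fubini_F /h /= ge0_integralZl//.
  over.
by rewrite ge0_integralZr// !ge0_integral_distribution.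
Qed.
End independence.

Section variance_sum.
Context d (T : measurableType d) (R : realType) (P : probability T R).

Lemma bounded_Lfun2 (X : T -> R) (M : R) : measurable_fun setT X ->
  (forall w, `|X w| <= M) -> X \in Lfun P 2%:E.
Proof.
move=> mX XM.
rewrite inE/=; apply/andP; split; rewrite inE//=.
rewrite /finite_norm unlock poweR_lty//.
apply/integrable_lty => //.
apply: (@le_integrable _ _ _ _ _ measurableT _ (EFin \o cst (M `^ 2))).
- by apply/measurable_EFinP; apply: measurableT_comp (measurable_powR _) _;
    exact: measurableT_comp.
- move=> w _ /=; rewrite lee_fin !(ger0_norm (powR_ge0 _ _)).
  by rewrite ge0_ler_powR// nnegrE ?normr_ge0// (le_trans _ (XM w)).
- exact: finite_measure_integrable_cst.
Qed.

(** Induction over duplicate-free sequences: the term that is added must be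
    uncorrelated with the sum of the others. *)
Lemma variance_sum_uncorrelated (I : finType) (X : I -> T -> R) :
  (forall i, X i \in Lfun P 2%:E) ->
  (forall i j, i != j -> covariance P (X i) (X j) = 0) ->
  'V_P[\sum_i X i] = (\sum_i 'V_P[X i])%E.
Proof.
move=> X2 cov0.
suff sum_uniq s : uniq s ->
    'V_P[\sum_(i <- s) X i] = (\sum_(i <- s) 'V_P[X i])%E.
  by apply: sum_uniq; exact: index_enum_uniq.
have S2 r : \sum_(i <- r) X i \in Lfun P 2%:E.
  by rewrite rpred_sum ?lee1n.
have covS i r : i \notin r -> covariance P (X i) (\sum_(j <- r) X j) = 0.
  elim: r => [|j r IH]; first by rewrite big_nil covariance_cst_r.
  rewrite inE negb_or => /andP[ij ir].
  by rewrite big_cons covarianceDr// cov0// IH// add0e.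
elim: s => [|i s IH]; first by rewrite !big_nil variance_cst.
move=> /andP[si us]; rewrite !big_cons.
by rewrite varianceD// covS// mule0 adde0 IH.
Qed.

End variance_sum.

(** [X ^+ 2 <= M * X] pointwise. *)
Lemma variance_bounded_le d (T : measurableType d) (R : realType)
    (P : probability T R) (X : T -> R) (M : R) :
  measurable_fun setT X -> (forall w, 0 <= X w <= M) ->
  ('V_P[X] <= M%:E * 'E_P[X])%E.
Proof.
move=> mX XM.
have X0 w : 0 <= X w by have /andP[] := XM w.
have XleM w : X w <= M by have /andP[] := XM w.
have X2 : X \in Lfun P 2%:E.
  by apply: (@bounded_Lfun2 _ _ _ _ _ M) => // w; rewrite ger0_norm.
have X1 : X \in Lfun P 1 by apply: Lfun_subset12 X2; exact: fin_num_measure.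
rewrite varianceE// (@le_trans _ _ ('E_P[X ^+ 2]))%E//.
  by rewrite leeBlDr ?fin_numX ?expectation_fin_num// leeDl// sqre_ge0.
rewrite -expectationZl// expectation_le//.
- by rewrite expr2; exact: measurable_funM.
- exact: measurable_funM.
- by move=> w; exact: sqr_ge0.
- by move=> w; rewrite mulr_ge0// (le_trans (X0 w)).
- by apply: aeW => w; rewrite expr2 ler_wpM2l.
Qed.

Section independent_average.
Context d (T : measurableType d) d' (T' : measurableType d') (R : realType).
Variables (P : probability T R) (N : nat) (Y : 'I_N -> {RV P >-> T'}).
Variables (k : T' -> R) (M : R).
Hypotheses (mk : measurable_fun setT k) (kM : forall x, 0 <= k x <= M).

Let k0 x : 0 <= k x. Proof. by have /andP[] := kM x. Qed.

Let X j w := k (Y j w).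

Let mX j : measurable_fun setT (X j). Proof. exact: measurableT_comp. Qed.

Let X2 j : X j \in Lfun P 2%:E.
Proof.
apply: (@bounded_Lfun2 _ _ _ _ _ M) => // w.
by rewrite ger0_norm; have /andP[] := kM (Y j w).
Qed.

Let X1 j : X j \in Lfun P 1.
Proof. by apply: Lfun_subset12 (X2 j); exact: fin_num_measure. Qed.

Let average w : R := N%:R^-1 * \sum_(j < N) k (Y j w).

Let averageE : average =
  (N%:R^-1 \o* \sum_(j < N) X j)%R.
Proof. by apply/funext => w /=; rewrite fct_sumE mulrC. Qed.

Lemma expectation_average :
  ('E_P[average] =
  (N%:R^-1)%:E * \sum_(j < N) 'E_P[X j])%E.
Proof.
rewrite averageE expectationZl ?rpred_sum//; congr (_ * _)%E.
rewrite unlock; under eq_integral do rewrite fct_sumE -sumEFin.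
by rewrite integral_sum// => j; exact/Lfun1_integrable.
Qed.

Lemma variance_independent_average : independent_RVs Y ->
  ('V_P[average] <=
   (N%:R^-1 * M)%:E * 'E_P[average])%E.
Proof.
move=> indepY; rewrite expectation_average averageE.
rewrite varianceZ ?rpred_sum ?lee1n// variance_sum_uncorrelated//; last first.
  move=> i j ij; rewrite covarianceE// ?Lfun2_mul_Lfun1//.
  have -> : ('E_P[X i * X j] = 'E_P[X i] * 'E_P[X j])%E.
    rewrite unlock.
    apply: (independent_RVs_expectationM indepY (f := EFin \o k)
      (g := EFin \o k)) => //.
    - exact/measurable_EFinP.
    - exact/measurable_EFinP.
  by rewrite subee//; apply: fin_numM; exact: expectation_fin_num.
have aM (a : R) (e : \bar R) :
    ((a * M)%:E * (a%:E * e) = (a ^+ 2)%:E * (M%:E * e))%E.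
  by rewrite !muleA -!EFinM; congr (_%:E * _)%E; ring.
rewrite aM lee_wpmul2l ?lee_fin ?sqr_ge0// ge0_sume_distrr//.
  by apply: lee_sum => j _; apply: variance_bounded_le => // w; exact: kM.
by move=> j _; apply: expectation_ge0 => w; exact: k0.
Qed.

End independent_average.

(** * The bandwidth and the constant of the variance bound *)

Section bandwidth.
Variables (R : realType) (nu : nat).

Let s N : R := bandwidth R nu N.

(** The ratio [bandwidth / bandwidth_hat]. *)
Definition shrinkage N : R := Num.sqrt (s N ^+ 2 + (N%:R - 1) / N%:R).

Lemma bandwidth_gt0 N : (1 <= N)%N -> 0 < s N.
Proof.
by move=> N1; rewrite powR_gt0// divr_gt0// mulr_gt0 ?ltr0n//.
Qed.

Lemma shrinkage_gt0 N : (1 <= N)%N -> 0 < shrinkage N.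
Proof.
move=> N1; rewrite sqrtr_gt0 ltr_wpDr ?exprn_gt0 ?bandwidth_gt0//.
by rewrite divr_ge0 ?ler0n// subr_ge0 ler1n.
Qed.

Lemma bandwidth_hat_gt0 N : (1 <= N)%N -> 0 < bandwidth_hat R nu N.
Proof. by move=> N1; rewrite divr_gt0 ?bandwidth_gt0 ?shrinkage_gt0. Qed.

(** With [c] the shrinkage, the argument of the kernel is [c^-1 *: (x - c *: eta)]
    and its standard deviation is [c^-1 * bandwidth]. The factor [c ^+ nu] is the
    ratio of the two normalizing constants. *)
Lemma gauss_kernelE N (x eta : 'rV[R]_nu) : (1 <= N)%N ->
  gauss_kernel N ((bandwidth_hat R nu N / bandwidth R nu N) *: x - eta) =
  shrinkage N ^+ nu * gauss_rV (shrinkage N *: eta) (bandwidth R nu N) x.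
Proof.
move=> N1; have s0 := bandwidth_gt0 N1; have c0 := shrinkage_gt0 N1.
have p0 : 0 < Num.sqrt (2 * pi : R) by rewrite sqrtr_gt0 mulr_gt0 ?pi_gt0.
rewrite /gauss_kernel /gauss_rV /bandwidth_hat -/(s N) -/(shrinkage N).
have -> : s N / shrinkage N / s N = (shrinkage N)^-1.
  by field; rewrite !gt_eqF.
have -> : enorm ((shrinkage N)^-1 *: x - eta) ^+ 2 =
    (shrinkage N) ^- 2 * enorm (x - shrinkage N *: eta) ^+ 2.
  rewrite !enorm_sqr mulr_sumr; apply: eq_bigr => i _; rewrite !mxE.
  by field; rewrite gt_eqF.
rewrite [RHS]mulrA; congr (_ * expR _).
  by rewrite !exprMn exprVn; field; rewrite !gt_eqF// exprn_gt0.
by field; rewrite !gt_eqF.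
Qed.

Lemma gauss_kernel_ge0 N (x : 'rV[R]_nu) : (1 <= N)%N -> 0 <= gauss_kernel N x.
Proof.
move=> N1; rewrite mulr_ge0 ?expR_ge0// invr_ge0 exprn_ge0// mulr_ge0//.
by rewrite ltW// bandwidth_hat_gt0.
Qed.

Lemma gauss_kernel_le N (x : 'rV[R]_nu) : (1 <= N)%N ->
  gauss_kernel N x <= ((Num.sqrt (2 * pi) * bandwidth_hat R nu N) ^+ nu)^-1.
Proof.
move=> N1; rewrite ler_piMr//.
  by rewrite invr_ge0 exprn_ge0// mulr_ge0// ltW// bandwidth_hat_gt0.
by rewrite expR_le1 mulNr oppr_le0 mulr_ge0 ?sqr_ge0// invr_ge0
  mulr_ge0 ?sqr_ge0.
Qed.

Lemma cvg_invn : (N%:R^-1 : R) @[N --> \oo] --> 0.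
Proof. by rewrite -cvg_shiftS; exact: cvg_harmonic. Qed.

Lemma bandwidth_cvg0 : s @ \oo --> 0.
Proof.
pose u N : R := 4 / (N%:R * (nu%:R + 2)).
have u0 : u @ \oo --> 0.
  rewrite (_ : u = fun N => 4 / (nu%:R + 2) * N%:R^-1).
    rewrite -[X in _ --> X](mulr0 (4 / (nu%:R + 2))); apply: cvgMl_tmp.
    exact: cvg_invn.
  by apply/funext => N; rewrite /u invfM mulrCA mulrC mulrAC.
have nu4 : 0 < (nu%:R + 4)^-1 :> R by rewrite invr_gt0 -natrD ltr0n addnS.
apply: cvg_trans (powR_cvg0 nu4).
apply: (cvg_app (fun x : R => x `^ (nu%:R + 4)^-1) (F := u @ \oo)).
move=> A /u0 uA.
have {}uA : \forall N \near \oo, 0 < u N -> A (u N) by exact: uA.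
suff : \forall N \near \oo, A (u N) by [].
near=> N; have : 0 < u N -> A (u N) by near: N.
apply.
by rewrite divr_gt0// mulr_gt0// ltr0n; near: N; exact: nbhs_infty_gt.
Unshelve. all: end_near. Qed.

Lemma shrinkage_cvg1 : shrinkage @ \oo --> (1 : R).
Proof.
have ratio : ((N%:R - 1) / N%:R : R) @[N --> \oo] --> (1 : R).
  have : (1 - N%:R^-1 : R) @[N --> \oo] --> (1 - 0 : R).
    by apply: cvgB; [exact: cvg_cst|exact: cvg_invn].
  rewrite subr0; apply: cvg_trans; apply: near_eq_cvg; near=> N.
  rewrite mulrBl mul1r divff// pnatr_eq0 -lt0n; near: N; exact: nbhs_infty_gt.
have c2 : (s N ^+ 2 + (N%:R - 1) / N%:R : R) @[N --> \oo] --> (0 ^+ 2 + 1 : R).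
  by apply: cvgD ratio; exact: cvg_expr_seq bandwidth_cvg0.
rewrite expr0n add0r in c2.
rewrite -[X in _ --> X](sqrtr1 R).
apply: (cvg_trans _ (@sqrt_continuous R 1)).
exact: (cvg_app (@Num.sqrt R) c2).
Unshelve. all: end_near. Qed.

(** [N^-1] times the maximum of the kernel, freed of its order of magnitude
    [N `^ (- (4 / (nu + 4)))]. *)
Definition variance_const N : R := N%:R `^ (4 / (nu%:R + 4)) *
  (N%:R^-1 * ((Num.sqrt (2 * pi) * bandwidth_hat R nu N) ^+ nu)^-1).

Lemma variance_const_gt0 N : (1 <= N)%N -> 0 < variance_const N.
Proof.
move=> N1; rewrite mulr_gt0 ?powR_gt0 ?ltr0n//.
rewrite mulr_gt0 ?invr_gt0 ?ltr0n// exprn_gt0// mulr_gt0 ?bandwidth_hat_gt0//.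
by rewrite sqrtr_gt0 mulr_gt0 ?pi_gt0.
Qed.

Lemma powR_variance_const N : (1 <= N)%N ->
  N%:R `^ (- (4 / (nu%:R + 4))) * variance_const N =
  N%:R^-1 * ((Num.sqrt (2 * pi) * bandwidth_hat R nu N) ^+ nu)^-1.
Proof.
by move=> N1; rewrite /variance_const powRN mulKf// gt_eqF// powR_gt0// ltr0n.
Qed.

Let theta : R := nu%:R / (nu%:R + 4).

Lemma bandwidth_expr N : (1 <= N)%N ->
  (s N ^+ nu)^-1 = N%:R `^ theta * ((2 + nu%:R) / 4) `^ theta.
Proof.
move=> N1; have N0 : 0 < N%:R :> R by rewrite ltr0n.
have nu2 : 0 < nu%:R + 2 :> R by rewrite -natrD ltr0n addn2.
have u0 : 0 <= 4 / (N%:R * (nu%:R + 2)) :> R.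
  by rewrite divr_ge0// mulr_ge0// ltW.
rewrite /s /bandwidth -powR_mulrn ?powR_ge0// -powRrM [_ * nu%:R]mulrC.
rewrite -/theta -powRM ?divr_ge0 ?addr_ge0//.
have -> : N%:R * ((2 + nu%:R) / 4) = (4 / (N%:R * (nu%:R + 2)))^-1 :> R.
  by field; rewrite !gt_eqF.
by rewrite -[in RHS]powR_inv1// -powRrM mulN1r powRN.
Qed.

(** The powers of [N] cancel because [4 / (nu + 4) + nu / (nu + 4) = 1]. *)
Lemma variance_constE N : (1 <= N)%N -> variance_const N =
  (2 * pi) `^ (- (nu%:R / 2)) * ((2 + nu%:R) / 4) `^ theta *
  shrinkage N ^+ nu.
Proof.
move=> N1; have N0 : 0 < N%:R :> R by rewrite ltr0n.
have pi2 : 0 < 2 * pi :> R by rewrite mulr_gt0 ?pi_gt0.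
have nu4 : 0 < nu%:R + 4 :> R by rewrite -natrD ltr0n addnS.
rewrite /variance_const /bandwidth_hat -/(s N) -/(shrinkage N).
rewrite exprMn expr_div_n invfM invf_div bandwidth_expr//.
have -> : (2 * pi) `^ (- (nu%:R / 2)) = (Num.sqrt (2 * pi) ^+ nu)^-1 :> R.
  rewrite powRN -powR12_sqrt ?ltW// -[in RHS]powR_mulrn ?powR_ge0// -powRrM.
  by rewrite [2^-1 * _]mulrC.
have NN : N%:R `^ (4 / (nu%:R + 4)) * N%:R `^ theta = N%:R.
  rewrite -powRD; last by apply/implyP => _; rewrite gt_eqF.
  by rewrite -mulrDl addrC divff ?gt_eqF// powRr1 ?ltW.
rewrite -[RHS]mul1r -[X in _ = X * _](divff (lt0r_neq0 N0)).
rewrite -[X in _ = X / _ * _]NN. ring.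
Qed.

Lemma variance_const_equiv : variance_const N / ((2 * pi) `^ (- (nu%:R / 2)) *
    ((2 + nu%:R) / 4) `^ theta) @[N --> \oo] --> (1 : R).
Proof.
have : shrinkage N ^+ nu @[N --> \oo] --> (1 : R).
  rewrite -[X in _ --> X](expr1n R nu).
  exact: cvg_expr_seq shrinkage_cvg1.
apply: cvg_trans; apply: near_eq_cvg; near=> N.
rewrite variance_constE; last by near: N; exact: nbhs_infty_gt.
by rewrite mulrC mulKf// mulf_neq0// gt_eqF// powR_gt0 ?mulr_gt0 ?pi_gt0.
Unshelve. all: end_near. Qed.

End bandwidth.

(** * The kernel density estimator *)

Section mean_of_estimator.
Context d (T : measurableType d) (R : realType) (P : probability T R).
Variables (nu : nat) (H : {RV P >-> 'rV[R]_nu}) (pH : 'rV[R]_nu -> R).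
Hypotheses (dH : has_density H pH).

Lemma density_integral1 : (\int[lebesgue_rV R nu]_x (pH x)%:E = 1)%E.
Proof.
have [_ _ <-//] := dH; exact: probability_setT.
Qed.

Lemma measurable_gauss_kernel N (eta : 'rV[R]_nu) : (1 <= N)%N ->
  measurable_fun setT (fun x : 'rV[R]_nu =>
    gauss_kernel N ((bandwidth_hat R nu N / bandwidth R nu N) *: x - eta)).
Proof.
move=> N1; under eq_fun do rewrite gauss_kernelE//.
by apply: measurable_funM => //; exact: measurable_gauss_rV.
Qed.

Lemma expectation_density_estimator N (Y : 'I_N -> {RV P >-> 'rV[R]_nu}) eta :
  (1 <= N)%N -> (forall j, same_distribution (Y j) H) ->
  ('E_P[density_estimator Y eta] = (shrinkage R nu N ^+ nu)%:E *
   \int[lebesgue_rV R nu]_x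
     (gauss_rV (shrinkage R nu N *: eta) (bandwidth R nu N) x * pH x)%:E)%E.
Proof.
move=> N1 YH; have [p0 mp Hp] := dH.
pose k (x : 'rV[R]_nu) :=
  gauss_kernel N ((bandwidth_hat R nu N / bandwidth R nu N) *: x - eta).
have mk : measurable_fun setT k by exact: measurable_gauss_kernel.
have k0 x : 0 <= k x by exact: gauss_kernel_ge0.
pose M : R := ((Num.sqrt (2 * pi) * bandwidth_hat R nu N) ^+ nu)^-1.
have kM x : 0 <= k x <= M by rewrite k0 gauss_kernel_le.
have s0 := bandwidth_gt0 R nu N1; have c0 := shrinkage_gt0 R nu N1.
transitivity ((N%:R^-1)%:E * \sum_(j < N) \int[distribution P H]_x (k x)%:E)%E.
  rewrite (expectation_average Y mk kM); congr (_ * _)%E; apply: eq_bigr => j _.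
  rewrite -(eq_measure_integral (distribution P H)
    (m1 := distribution P (Y j))).
    by rewrite unlock (ge0_integral_distribution (Y j) (f := EFin \o k))//;
      exact/measurable_EFinP.
  by move=> A mA _; exact: YH.
have N0 : N%:R != 0 :> R by rewrite pnatr_eq0 -lt0n.
set I := (\int[_]_x (k x)%:E)%E.
have -> : (\sum_(j < N) I = N%:R%:E * I)%E.
  rewrite -[in LHS](mul1e I) -ge0_sume_distrl; last first.
    by move=> _ _; rewrite lee_fin.
  by rewrite sumEFin sumr_const card_ord.
rewrite muleA -EFinM mulVf// mul1e /I.
rewrite (integral_density (mu := lebesgue_rV R nu) (p := EFin \o pH))//.
- rewrite -ge0_integralZl//; last 3 first.
  + apply/measurable_EFinP; apply: measurable_funM => //.
    exact: measurable_gauss_rV.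
  + by move=> x _; rewrite lee_fin mulr_ge0// gauss_rV_ge0// ltW.
  + by rewrite lee_fin exprn_ge0// ltW.
  by apply: eq_integral => x _; rewrite /= -!EFinM /k gauss_kernelE// -mulrA.
- exact/measurable_EFinP.
- apply: measurable_bounded_integrable => //.
    by rewrite -ge0_fin_numE // fin_num_measure.
  exists M; split; first exact: num_real.
  move=> b Mb x _; have /andP[_ kxM] := kM x.
  by rewrite /= ger0_norm// (le_trans kxM)// ltW.
Qed.

Lemma cvg_expectation_density_estimator
    (Y : forall N : nat, 'I_N -> {RV P >-> 'rV[R]_nu}) eta :
  {for eta, continuous pH} -> (forall N j, same_distribution (Y N j) H) ->
  'E_P[density_estimator (Y N) eta]%E @[N --> \oo] --> (pH eta)%:E.
Proof.
move=> cp YH; have [p0 mp Hp] := dH.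
have nearN1 : \forall N \near \oo, (1 <= N)%N by exact: nbhs_infty_gt.
have cvgm : (\int[lebesgue_rV R nu]_x
    (gauss_rV (shrinkage R nu N *: eta) (bandwidth R nu N) x * pH x)%:E)%E
    @[N --> \oo] --> (pH eta)%:E.
  apply: gauss_rV_mean_cvg => //.
  - exact: density_integral1.
  - move=> i; rewrite -[X in _ --> X]mul1r.
    under eq_fun do rewrite mxE.
    by apply: cvgMr_tmp; exact: shrinkage_cvg1.
  - by apply: filterS nearN1 => N; exact: bandwidth_gt0.
  - exact: bandwidth_cvg0.
have cvgc : ((shrinkage R nu N ^+ nu)%:E @[N --> \oo] --> (1 ^+ nu : R)%:E).
  by apply: cvg_EFin; [near=> N|exact: cvg_expr_seq (@shrinkage_cvg1 R nu)].
have -> : (pH eta)%:E = ((1 ^+ nu : R)%:E * (pH eta)%:E)%E.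
  by rewrite expr1n mul1e.
apply: cvg_trans (cvgeM _ cvgc cvgm) => //.
apply: near_eq_cvg; near=> N; rewrite expectation_density_estimator//.
by near: N.
Unshelve. all: end_near. Qed.

End mean_of_estimator.

Unset Implicit Arguments.

Theorem theorem1 (R : realType) (nu : nat) (hnu : (1 <= nu)%N) :
  exists beta : nat -> R,
    [/\ forall N : nat, (1 <= N)%N -> 0 < beta N,
        beta N / ((2 * pi) `^ (- (nu%:R / 2)) *
                  ((2 + nu%:R) / 4) `^ (nu%:R / (nu%:R + 4)))
          @[N --> \oo] --> (1 : R) &
        forall (d : measure_display) (T : measurableType d)
               (P : probability T R) (H : {RV P >-> 'rV[R]_nu})
               (pH : 'rV[R]_nu -> R)
               (Hhat : forall N : nat, 'I_N -> {RV P >-> 'rV[R]_nu}),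
          has_density H pH -> continuous pH ->
          (forall N : nat, independent_copies H (Hhat N)) ->
          forall eta : 'rV[R]_nu,
            'E_P[density_estimator (Hhat N) eta]%E @[N --> \oo]
              --> (pH eta)%:E /\
            forall N : nat, (1 <= N)%N ->
              ('V_P[density_estimator (Hhat N) eta] <=
               (N%:R `^ (- (4 / (nu%:R + 4))) * beta N)%:E *
               'E_P[density_estimator (Hhat N) eta])%E].

Proof.
exists (variance_const R nu); split.
- exact: variance_const_gt0.
- exact: variance_const_equiv.
move=> d T P H pH Y dH cH copies eta; split.
  apply: (cvg_expectation_density_estimator dH); first exact: cH.
  by move=> N; have [] := copies N.
move=> N N1; rewrite powR_variance_const//.
have [_ indepY] := copies N.
pose k x :=
  gauss_kernel N ((bandwidth_hat R nu N / bandwidth R nu N) *: x - eta).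
have kM x : 0 <= k x <= ((Num.sqrt (2 * pi) * bandwidth_hat R nu N) ^+ nu)^-1.
  by rewrite gauss_kernel_ge0// gauss_kernel_le.
exact: variance_independent_average (measurable_gauss_kernel eta N1) kM indepY.
Qed.
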